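(* Consider the two-stage loss $\ell(x,\xi)=c^\top x+\inf_{y\in\mathbb R^{D_y}}\{q^\top y:\ T(x)\xi+h(x)\le Wy\}$. Then the problem $$\begin{aligned}\min\ &\alpha+\beta\Omega+\frac1M\sum_{m\in[M]}\nu_m\big(\mathbb E_{\hat{\mathbb P}_N}[\ell(z_m,\xi)]+\epsilon\big)\\ \text{s.t. }&x\in\mathcal X,\ \alpha\in\mathbb R,\ \beta\in\mathbb R_+,\ \nu\in\mathbb R_+^M,\\ &\ell(x,\xi)\le\alpha+\beta\|\xi\|^2+\frac1M\sum_{m\in[M]}\nu_m\ell(z_m,\xi)\qquad\forall\xi\in\Xi\end{aligned}$$ can be conservatively approximated by the conic program $$\begin{aligned}\min\ &\alpha+\beta\Omega+\frac1M\sum_{m\in[M]}\nu_m\big(\mathbb E_{\hat{\mathbb P}_N}[\ell(z_m,\xi)]+\epsilon\big)\\ \text{s.t. }&x\in\mathcal X,\ \alpha\in\mathbb R,\ \beta\in\mathbb R_+,\ \nu\in\mathbb R_+^M,\\ &\lambda_m\in\mathbb R_+^L\ \ \forall m\in[M],\quad\theta\in\mathbb R^{D_\xi},\ \zeta\in\mathbb R_+,\quad Y\in\mathbb R^{D_y\times D_\xi},\ y_0\in\mathbb R^{D_y},\\ &\sigma_\Xi\big([T(x)-WY]_{l:}^\top\big)\le[Wy_0-h(x)]_l\quad\forall l\in[L],\\ &\zeta+\sigma_\Xi(\theta)+c^\top x+q^\top y_0-\frac1M\sum_{m\in[M]}\big(\nu_mc^\top z_m+h(z_m)^\top\lambda_m\big)\le\alpha,\\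 &\left\|\begin{bmatrix}Y^\top q-\frac1M\sum_{m\in[M]}T(z_m)^\top\lambda_m-\theta\\ \zeta-\beta\end{bmatrix}\right\|\le\zeta+\beta,\\ &W^\top\lambda_m=\nu_mq\quad\forall m\in[M].\end{aligned}$$ That is, for every feasible solution of the conic program, its components $(x,\alpha,\beta,\nu)$ are feasible in the first problem with the same objective value.
   Context: $\mathcal X\subseteq\mathbb R^{D_x}$ is compact and convex, and $\Xi\subseteq\mathbb R^{D_\xi}$ is the support set of the uncertain parameter $\xi$. $T(x)\in\mathbb R^{L\times D_\xi}$ and $h(x)\in\mathbb R^L$ depend affinely on $x$, $W\in\mathbb R^{L\times D_y}$ is a fixed recourse matrix, $c\in\mathbb R^{D_x}$, $q\in\mathbb R^{D_y}$. Relatively complete recourse is assumed: the recourse linear program is feasible for every $x\in\mathcal X$ and $\xi\in\Xi$, and strong linear programming duality holds, so $\ell(x,\xi)=c^\top x+\sup_{p\in\mathbb R_+^L}\{(T(x)\xi+h(x))^\top p:\ q=W^\top p\}$, which is a piecewise affine (real-valued) loss. $\hat{\mathbb P}_N$ is a data-driven reference distribution on $\Xi$ and $\Omega$ is a second-moment budget with $\mathbb E_{\hat{\mathbb P}_N}[\|\xi\|^2]<\Omega$; $\epsilon\ge0$; $z_1,\dots,z_M\in\mathcal X$ are given sampled points. $\sigma_\Xi(\theta)=\sup_{\xi\in\Xi}\theta^\top\xi$ is the support function; $[B]_{l:}$ is the $l$-th row of a matrix $B$, $[v]_l$ the $l$-th component of a vector $v$; $[M]=\{1,\dots,M\}$;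 $\|\cdot\|$ is the Euclidean norm. *)

(* Defs.v *)
From HB Require Import structures.
From mathcomp Require Import all_boot all_order all_algebra.
From mathcomp Require Import all_classical all_reals all_analysis.

Set Implicit Arguments.
Unset Strict Implicit.
Unset Printing Implicit Defensive.

Import Order.TTheory GRing.Theory Num.Theory.
Import numFieldNormedType.Exports.

Local Open Scope classical_set_scope.
Local Open Scope ring_scope.

Definition dot (R : realType) (n : nat) (u v : 'cV[R]_n) : R :=
  \sum_(i < n) u i 0 * v i 0.

(* The library's norm on matrices is the max norm; only its topology, which
   is the Euclidean one, is used. *)
Definition enorm (R : realType) (n : nat) (u : 'cV[R]_n) : R :=
  Num.sqrt (dot u u).

Definition vle (R : realType) (n : nat) (u v : 'cV[R]_n) : Prop :=
  forall i, u i 0 <= v i 0.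

Definition affine_map (R : realType) (U V : lmodType R) (f : U -> V) : Prop :=
  exists (g : {linear U -> V}) (b : V), forall x, f x = g x + b.

Definition support_fun (R : realType) (n : nat) (A : set 'cV[R]_n)
    (t : 'cV[R]_n) : \bar R :=
  ereal_sup [set (dot t xi)%:E | xi in A].

(* R^n with its Borel sigma-algebra. *)
Definition borel_cV (R : realType) (n : nat) :=
  g_sigma_algebraType (@open 'cV[R]_n).

Record two_stage (R : realType) (Dx Dxi Dy L : nat) := TwoStage {
  tsT : 'cV[R]_Dx -> 'M[R]_(L, Dxi);
  tsh : 'cV[R]_Dx -> 'cV[R]_L;
  tsW : 'M[R]_(L, Dy);
  tsc : 'cV[R]_Dx;
  tsq : 'cV[R]_Dy }.

Section TwoStage.
Context (R : realType) (Dx Dxi Dy L : nat) (S : two_stage R Dx Dxi Dy L).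

Definition recourse_rhs (x : 'cV[R]_Dx) (xi : 'cV[R]_Dxi) : 'cV[R]_L :=
  tsT S x *m xi + tsh S x.

Definition recourse_feasible (x : 'cV[R]_Dx) (xi : 'cV[R]_Dxi) : set 'cV[R]_Dy :=
  [set y | vle (recourse_rhs x xi) (tsW S *m y)].

(* Extended-real valued: +oo when the recourse problem is infeasible, -oo when
   it is unbounded. Under [complete_recourse] and [strong_duality] it is finite
   on X * Xi, so no sum of opposite infinities arises there. *)
Definition loss (x : 'cV[R]_Dx) (xi : 'cV[R]_Dxi) : \bar R :=
  ((dot (tsc S) x)%:E +
   ereal_inf [set (dot (tsq S) y)%:E | y in recourse_feasible x xi])%E.

Definition dual_loss (x : 'cV[R]_Dx) (xi : 'cV[R]_Dxi) : \bar R :=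
  ((dot (tsc S) x)%:E +
   ereal_sup [set (dot (recourse_rhs x xi) p)%:E |
              p in [set p : 'cV[R]_L | vle 0 p /\ tsq S = (tsW S)^T *m p]])%E.

Definition complete_recourse (X : set 'cV[R]_Dx) (Xi : set 'cV[R]_Dxi) : Prop :=
  forall x xi, X x -> Xi xi -> recourse_feasible x xi !=set0.

Definition strong_duality (X : set 'cV[R]_Dx) (Xi : set 'cV[R]_Dxi) : Prop :=
  forall x xi, X x -> Xi xi ->
    loss x xi \is a fin_num /\ loss x xi = dual_loss x xi.

Context (X : set 'cV[R]_Dx) (Xi : set 'cV[R]_Dxi).
Context (P : probability (borel_cV R Dxi) R) (Omega eps : R).
Context (M : nat) (z : 'I_M -> 'cV[R]_Dx).

(* The expectation is written as an integral over the whole space because Xi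
   need not be Borel; P is assumed to be concentrated on Xi, outside of which
   the values of the loss are irrelevant. *)
Definition objective (alpha beta : R) (nu : 'cV[R]_M) : \bar R :=
  ((alpha + beta * Omega)%:E +
   (M%:R^-1)%:E *
     \sum_(m < M) (nu m 0)%:E * (\int[P]_xi loss (z m) xi + eps%:E))%E.

(* Problem with one constraint for each xi in Xi. *)
Record semiinf_var := SemiinfVar {
  sx : 'cV[R]_Dx; salpha : R; sbeta : R; snu : 'cV[R]_M }.

Definition semiinf_feasible (v : semiinf_var) : Prop :=
  [/\ X (sx v), 0 <= sbeta v, vle 0 (snu v) &
      forall xi, Xi xi ->
        (loss (sx v) xi <= (salpha v + sbeta v * enorm xi ^+ 2)%:E +
           (M%:R^-1)%:E * \sum_(m < M) (snu v m 0)%:E * loss (z m) xi)%E].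

Definition semiinf_objective (v : semiinf_var) : \bar R :=
  objective (salpha v) (sbeta v) (snu v).

Record conic_var := ConicVar {
  kx : 'cV[R]_Dx; kalpha : R; kbeta : R; knu : 'cV[R]_M;
  klambda : 'I_M -> 'cV[R]_L; ktheta : 'cV[R]_Dxi; kzeta : R;
  kY : 'M[R]_(Dy, Dxi); ky0 : 'cV[R]_Dy }.

Definition conic_sign (v : conic_var) : Prop :=
  [/\ 0 <= kbeta v, vle 0 (knu v), forall m, vle 0 (klambda v m) &
      0 <= kzeta v].

Definition conic_support (v : conic_var) : Prop :=
  forall l : 'I_L,
    (support_fun Xi (row l (tsT S (kx v) - tsW S *m kY v))^T
       <= ((tsW S *m ky0 v - tsh S (kx v)) l 0)%:E)%E.

Definition conic_epigraph (v : conic_var) : Prop :=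
  ((kzeta v)%:E + support_fun Xi (ktheta v) +
     (dot (tsc S) (kx v) + dot (tsq S) (ky0 v) -
      M%:R^-1 * \sum_(m < M) (knu v m 0 * dot (tsc S) (z m) +
                              dot (tsh S (z m)) (klambda v m)))%:E
   <= (kalpha v)%:E)%E.

(* [const_mx a : 'cV_1] is the scalar a as the last component of the block
   vector, which lives in R^(Dxi + 1). *)
Definition conic_soc (v : conic_var) : Prop :=
  enorm (col_mx
    ((kY v)^T *m tsq S
     - M%:R^-1 *: (\sum_(m < M) (tsT S (z m))^T *m klambda v m)
     - ktheta v)
    (const_mx (kzeta v - kbeta v) : 'cV[R]_1))
  <= kzeta v + kbeta v.

Definition conic_dual (v : conic_var) : Prop :=
  forall m, (tsW S)^T *m klambda v m = knu v m 0 *: tsq S.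

Definition conic_feasible (v : conic_var) : Prop :=
  X (kx v) /\
  [/\ conic_sign v, conic_support v, conic_epigraph v, conic_soc v &
      conic_dual v].

Definition conic_objective (v : conic_var) : \bar R :=
  objective (kalpha v) (kbeta v) (knu v).

Definition semiinf_of_conic (v : conic_var) : semiinf_var :=
  SemiinfVar (kx v) (kalpha v) (kbeta v) (knu v).

End TwoStage.

(* Main.v *)
Require Import Defs.
From mathcomp Require Import all_boot all_order all_algebra.
From mathcomp Require Import all_classical all_reals all_analysis.
From mathcomp Require Import lra.
Import Order.TTheory GRing.Theory Num.Theory.
Import numFieldNormedType.Exports.
Local Open Scope classical_set_scope.
Local Open Scope ring_scope.

Set Implicit Arguments.
Unset Strict Implicit.

(** The conic constraints certify the semi-infinite constraint at each [xi]
    separately, with [Y xi + y0] as a recourse decision for [x] and [lambda m]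
    as a (scaled) dual solution of the recourse problem of [z m].

    The support constraints say that the affine decision rule [Y xi + y0] is
    feasible for every [xi] in [Xi], so [loss x xi] is at most
    [c.x + q.(Y xi + y0)] ([loss_affine_rule]). In the other direction, weak
    duality ([scaled_weak_duality]) bounds [nu m * loss (z m) xi] from below by
    an expression that is affine in [xi], with slope [T(z m)^T lambda m]. What
    is left is an inequality between a quadratic and an affine function of
    [xi]:
      [q.(Y xi + y0) + c.x
         <= alpha + beta |xi|^2 + affine lower bounds of the losses at the z m].
    Call [theta + w] the difference of the slopes of the affine terms. The
    epigraph constraint leaves room for [zeta + theta.xi], since [theta.xi] is
    at most the support function of [Xi] at [theta]. The second-order cone
    constraint is the rotated cone [|w|^2 <= 4 zeta beta], which by completing
    the square says that [w.xi <= zeta + beta |xi|^2] for all [xi]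
    ([soc_quadratic]).

    The objectives agree by definition, since both are the same function of
    [alpha], [beta] and [nu]. *)

(** * The Euclidean inner product *)

Section InnerProduct.
Variable R : realType.

Lemma dotE n (u v : 'cV[R]_n) : dot u v = (u^T *m v) 0 0.
Proof. by rewrite mxE; apply: eq_bigr => i _; rewrite mxE. Qed.

Lemma dotC n (u v : 'cV[R]_n) : dot u v = dot v u.
Proof. by apply: eq_bigr => i _; rewrite mulrC. Qed.

Lemma dotDl n (u v w : 'cV[R]_n) : dot (u + v) w = dot u w + dot v w.
Proof. by rewrite !dotE linearD mulmxDl mxE. Qed.

Lemma dotBl n (u v w : 'cV[R]_n) : dot (u - v) w = dot u w - dot v w.
Proof. by rewrite !dotE linearB mulmxBl !mxE. Qed.

Lemma dotZl n a (u v : 'cV[R]_n) : dot (a *: u) v = a * dot u v.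
Proof. by rewrite !dotE linearZ -scalemxAl mxE. Qed.

Lemma dotDr n (u v w : 'cV[R]_n) : dot u (v + w) = dot u v + dot u w.
Proof. by rewrite ![dot u _]dotC dotDl. Qed.

Lemma dot_suml n (I : finType) (F : I -> 'cV[R]_n) (w : 'cV[R]_n) :
  dot (\sum_i F i) w = \sum_i dot (F i) w.
Proof.
rewrite /dot exchange_big /=; apply: eq_bigr => i _.
by rewrite summxE mulr_suml.
Qed.

Lemma dot_trmxl m n (A : 'M[R]_(m, n)) (u : 'cV[R]_m) (v : 'cV[R]_n) :
  dot (A^T *m u) v = dot u (A *m v).
Proof. by rewrite !dotE trmx_mul trmxK mulmxA. Qed.

Lemma dot_row m n (A : 'M[R]_(m, n)) (v : 'cV[R]_n) i :
  dot (row i A)^T v = (A *m v) i 0.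
Proof. by rewrite dotE trmxK -row_mul mxE. Qed.

Lemma dot_ge0 n (u : 'cV[R]_n) : 0 <= dot u u.
Proof. by apply: sumr_ge0 => i _; rewrite -expr2 sqr_ge0. Qed.

Lemma dot_eq0 n (u : 'cV[R]_n) : dot u u <= 0 -> u = 0.
Proof.
move=> u_le0; apply/colP => i; rewrite mxE; apply/eqP.
have /eqP : dot u u = 0 by apply/le_anti; rewrite u_le0 dot_ge0.
rewrite psumr_eq0 => [/allP /(_ i (mem_index_enum i))|j _].
  by rewrite /= mulf_eq0 orbb.
by rewrite -expr2 sqr_ge0.
Qed.

Lemma dot0l n (v : 'cV[R]_n) : dot 0 v = 0.
Proof. by rewrite /dot big1 // => i _; rewrite mxE mul0r. Qed.

Lemma enorm_sqr n (u : 'cV[R]_n) : enorm u ^+ 2 = dot u u.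
Proof. by rewrite sqr_sqrtr // dot_ge0. Qed.

Lemma dot_col_mx m n (a c : 'cV[R]_m) (b d : 'cV[R]_n) :
  dot (col_mx a b) (col_mx c d) = dot a c + dot b d.
Proof. by rewrite !dotE tr_col_mx mul_row_col mxE. Qed.

Lemma ler_dotl n (p u v : 'cV[R]_n) :
  vle 0 p -> vle u v -> dot u p <= dot v p.
Proof.
move=> p_ge0 uv; apply: ler_sum => i _; apply: ler_wpM2r (uv i).
by have := p_ge0 i; rewrite mxE.
Qed.

Lemma dot_le_support n (A : set 'cV[R]_n) (t xi : 'cV[R]_n) :
  A xi -> ((dot t xi)%:E <= support_fun A t)%E.
Proof. by move=> Axi; apply: ereal_sup_ubound; exists xi. Qed.

(** * The second-order cone constraint *)

(** Squaring turns the cone constraint into [|w|^2 <= 4 zeta beta]. For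
    [beta > 0], the conclusion multiplied by [4 beta] follows from
    [0 <= |w - 2 beta xi|^2]; for [beta = 0] the constraint forces [w = 0]. *)
Lemma soc_quadratic n (w : 'cV[R]_n) (zeta beta : R) (xi : 'cV[R]_n) :
  0 <= zeta -> 0 <= beta ->
  enorm (col_mx w (const_mx (zeta - beta) : 'cV[R]_1)) <= zeta + beta ->
  dot w xi <= zeta + beta * enorm xi ^+ 2.
Proof.
move=> zeta_ge0 beta_ge0 soc; rewrite enorm_sqr.
have ww : dot w w <= 4 * zeta * beta.
  have : enorm (col_mx w (const_mx (zeta - beta) : 'cV[R]_1)) ^+ 2
           <= (zeta + beta) ^+ 2.
    by rewrite ler_sqr ?nnegrE ?sqrtr_ge0 ?addr_ge0.
  rewrite enorm_sqr dot_col_mx [X in _ + X]/dot big_ord1 !mxE; lra.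
have [beta_gt0|] := ltP 0 beta; last first.
  move=> beta_le0; have beta0 : beta = 0 by apply/le_anti/andP.
  have -> : w = 0 by apply: dot_eq0; move: ww; rewrite beta0 mulr0.
  by rewrite dot0l beta0 mul0r addr0.
have := dot_ge0 (w - (2 * beta) *: xi).
rewrite !dotBl ![dot _ (w - _)]dotC !dotBl !dotZl.
rewrite ![dot _ (_ *: _)]dotC !dotZl [dot xi w]dotC => sq.
rewrite -(ler_pM2l (mulr_gt0 (ltr0n R 4) beta_gt0)); nra.
Qed.

End InnerProduct.

(** * Bounds on the two-stage loss *)

Section Loss.
Variables (R : realType) (Dx Dxi Dy L : nat) (S : two_stage R Dx Dxi Dy L).
Implicit Types (x : 'cV[R]_Dx) (xi : 'cV[R]_Dxi).

Lemma loss_le x xi y : recourse_feasible S x xi y ->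
  (loss S x xi <= (dot (tsc S) x + dot (tsq S) y)%:E)%E.
Proof.
move=> y_feas; rewrite EFinD leeD2l //.
by apply: ereal_inf_lbound; exists y.
Qed.

(** The support constraint of row [l] bounds, uniformly in [xi], the
    difference between the two sides of row [l] of the recourse constraint
    under the affine decision rule. *)
Lemma loss_affine_rule (Xi : set 'cV[R]_Dxi) M
    (v : conic_var R Dx Dxi Dy L M) xi :
  conic_support S Xi v -> Xi xi ->
  (loss S (kx v) xi
     <= (dot (tsc S) (kx v) + dot (tsq S) (kY v *m xi + ky0 v))%:E)%E.
Proof.
move=> supp Xixi; apply: loss_le => l.
have := le_trans (dot_le_support _ Xixi) (supp l).
rewrite lee_fin dot_row mulmxBl /recourse_rhs mulmxDr mulmxA !mxE; lra.
Qed.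

(** [lam] is [nu] times a dual solution when [nu > 0]. When [nu = 0] it is a
    recession direction of the dual polyhedron, along which the dual objective
    cannot increase because the primal is feasible. One argument covers both
    cases: every feasible [y] has [rhs.lam <= (W y).lam = nu (q.y)]. *)
Lemma scaled_weak_duality x xi (nu r : R) (lam : 'cV[R]_L) :
  recourse_feasible S x xi !=set0 ->
  loss S x xi = r%:E -> 0 <= nu -> vle 0 lam ->
  (tsW S)^T *m lam = nu *: tsq S ->
  nu * dot (tsc S) x + dot (recourse_rhs S x xi) lam <= nu * r.
Proof.
move=> [y0 y0_feas] loss_r nu_ge0 lam_ge0 Wlam.
have weak y : recourse_feasible S x xi y ->
    dot (recourse_rhs S x xi) lam <= nu * dot (tsq S) y.
  move=> /(ler_dotl lam_ge0).
  by rewrite [dot (_ *m _) _]dotC -dot_trmxl Wlam dotZl.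
have [nu_gt0|nu_le0] := ltP 0 nu; last first.
  have nu0 : nu = 0 by apply/le_anti/andP.
  by have := weak _ y0_feas; rewrite nu0 !mul0r add0r.
have : ((dot (tsc S) x + dot (recourse_rhs S x xi) lam / nu)%:E <= r%:E)%E.
  rewrite -loss_r EFinD leeD2l //; apply/ereal_infP => _ [y y_feas <-].
  by rewrite lee_fin ler_pdivrMr // mulrC weak.
by rewrite lee_fin -(ler_pM2l nu_gt0) mulrDr [_ * (_ / _)]mulrC divfK ?gt_eqF.
Qed.

End Loss.

(** * The conservative approximation *)

Unset Implicit Arguments.
Set Strict Implicit.

Theorem theorem10 (R : realType) (Dx Dxi Dy L M : nat) (hM : (0 < M)%N)
    (X : set 'cV[R]_Dx) (Xi : set 'cV[R]_Dxi)
    (S : two_stage R Dx Dxi Dy L)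
    (P : probability (borel_cV R Dxi) R) (Omega eps : R)
    (z : 'I_M -> 'cV[R]_Dx)
    (hXcompact : compact X) (hXconvex : convex_set X)
    (hT : affine_map (tsT S)) (hh : affine_map (tsh S))
    (hrecourse : complete_recourse S X Xi)
    (hduality : strong_duality S X Xi)
    (hP : {ae P, forall xi, Xi xi})
    (hOmega : (\int[P]_xi (enorm xi ^+ 2)%:E < Omega%:E)%E)
    (heps : 0 <= eps)
    (hz : forall m, X (z m))
    (v : conic_var R Dx Dxi Dy L M) (hv : conic_feasible S X Xi z v) :
  semiinf_feasible S X Xi z (semiinf_of_conic v) /\
  semiinf_objective S P Omega eps z (semiinf_of_conic v) =
    conic_objective S P Omega eps z v.
Proof.
split=> //.
have [Xx [[beta_ge0 nu_ge0 lam_ge0 zeta_ge0] supp epi soc dual]] := hv.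
split=> //= xi Xixi.
have loss_fin m : loss S (z m) xi = (fine (loss S (z m) xi))%:E.
  by rewrite fineK //; have [] := hduality (z m) xi (hz m) Xixi.
apply: le_trans (loss_affine_rule supp Xixi) _.
under eq_bigr => m _ do rewrite loss_fin -EFinM.
rewrite sumEFin -EFinM -EFinD lee_fin.
have epi_xi :=
  le_trans (leeD2r _ (leeD2l _ (dot_le_support (ktheta v) Xixi))) epi.
rewrite -!EFinD lee_fin in epi_xi.
have quad := soc_quadratic xi zeta_ge0 beta_ge0 soc.
rewrite !dotBl dot_trmxl dotZl dot_suml in quad.
have lower : \sum_(m < M) (knu v m 0 * dot (tsc S) (z m)
                           + dot (tsh S (z m)) (klambda v m))
             + \sum_(m < M) dot ((tsT S (z m))^T *m klambda v m) xi
             <= \sum_(m < M) knu v m 0 * fine (loss S (z m) xi).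
  rewrite -big_split; apply: ler_sum => m _ /=.
  have nu_m : 0 <= knu v m 0 by have := nu_ge0 m; rewrite mxE.
  have := scaled_weak_duality (hrecourse _ _ (hz m) Xixi)
            (loss_fin m) nu_m (lam_ge0 m) (dual m).
  by rewrite dotDl dot_trmxl [dot (klambda v m) _]dotC; lra.
have := ler_wpM2l (_ : 0 <= M%:R^-1 :> R) lower.
rewrite invr_ge0 ler0n mulrDr dotDr => /(_ isT); lra.
Qed.
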